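(* Let $C\ge 1$ be an integer and write $C=\frac{k(k+1)}{2}+r$ with integers $k\ge 1$ and $0\le r\le k$. Then for every $N\ge 2$, $$A(C,N)\ \ge\ \left\lceil \frac{N(N-1)}{2}\cdot\frac{k+1}{k(k+1)+r}\right\rceil .$$
   Context: Fix integers $N\ge 2$ and $C\ge 1$ (the grooming factor). Let $\vec C_N$ be the directed cycle on vertices $0,1,\dots,N-1$ with arcs $(i,i+1 \bmod N)$. For distinct vertices $u,v$ let $d(u,v)=(v-u)\bmod N\in\{1,\dots,N-1\}$ be the length of the directed path from $u$ to $v$ in $\vec C_N$. A request tournament $T_N$ is a tournament on $\{0,\dots,N-1\}$ containing every arc $(u,v)$ with $d(u,v)<N/2$ and, when $N$ is even, exactly one of the two arcs $(i,i+N/2)$, $(i+N/2,i)$ for each $0\le i<N/2$ (this choice being free). Each arc $(u,v)$ of $T_N$ is routed along the directed path from $u$ to $v$ in $\vec C_N$. For a subdigraph $B$ of $T_N$ and an arc $e$ of $\vec C_N$, the load $L(B,e)$ is the number of arcs of $B$ whose route contains $e$; $B$ is admissible if $L(B,e)\le C$ for every arc $e$ of $\vec C_N$. A valid partition is a partition of the arc set of $T_N$ into admissible subdigraphs $B_1,\dots,B_W$, where $V(B_\omega)$ denotes the set of endpoints of arcs of $B_\omega$; its cost is $\sum_{\omega=1}^W |V(B_\omega)|$. $A(C,N)$ denotes the minimum cost of a valid partition, over all choices of the request tournament $T_N$ and all valid partitions of it. *)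

(* Defs.v *)
From mathcomp Require Import all_boot.

Set Implicit Arguments.
Unset Strict Implicit.
Unset Printing Implicit Defensive.

Definition arc (N : nat) : finType := ('I_N * 'I_N)%type.

(* [ordS i] is the successor of [i] modulo [N]. *)
Definition cycle_arcs (N : nat) : {set arc N} :=
  [set (i, ordS i) | i : 'I_N].

(* (v - u) mod N, avoiding truncated subtraction. *)
Definition dist (N : nat) (u v : 'I_N) : nat := (v + (N - u)) %% N.

Definition route (N : nat) (a : arc N) : {set arc N} :=
  [set (iter j (@ordS N) a.1, iter j.+1 (@ordS N) a.1) | j : 'I_(dist a.1 a.2)].

Definition tournament (N : nat) (T : {set arc N}) : bool :=
  [forall u : 'I_N, (u, u) \notin T] &&
  [forall u : 'I_N, forall v : 'I_N,
     (u != v) ==> (((u, v) \in T) (+) ((v, u) \in T))].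

(* Since [j] ranges over ordinals, [j = i + N./2] forces [i < N./2]. *)
Definition request_tournament (N : nat) (T : {set arc N}) : bool :=
  [&& tournament T,
      [forall u : 'I_N, forall v : 'I_N,
         (u != v) && (2 * dist u v < N) ==> ((u, v) \in T)]
    & ~~ odd N ==>
      [forall i : 'I_N, forall j : 'I_N,
         (j == i + N./2 :> nat) ==> (((i, j) \in T) (+) ((j, i) \in T))]].

Definition load (N : nat) (B : {set arc N}) (e : arc N) : nat :=
  #|[set a in B | e \in route a]|.

Definition admissible (C N : nat) (B : {set arc N}) : bool :=
  [forall e in cycle_arcs N, load B e <= C].

Definition endpoints (N : nat) (B : {set arc N}) : {set 'I_N} :=
  [set a.1 | a in B] :|: [set a.2 | a in B].

(* [partition] forbids empty blocks; these would cost nothing anyway. *)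
Definition valid_partition (C N : nat) (T : {set arc N})
    (P : {set {set arc N}}) : bool :=
  partition P T && [forall B in P, admissible C B].

Definition cost (N : nat) (P : {set {set arc N}}) : nat :=
  \sum_(B in P) #|endpoints B|.

Definition attainable_cost (C N : nat) : pred nat := fun c =>
  [exists T : {set arc N}, request_tournament T &&
    [exists P : {set {set arc N}}, valid_partition C T P && (cost P == c)]].

Lemma dist_opp (N : nat) (u v : 'I_N) : u != v -> dist u v + dist v u = N.
Proof.
have main (x y : 'I_N) : x < y -> dist x y + dist y x = N.
  move=> xy; have yN := ltn_ord y; have xN := ltn_ord x.
  have -> : dist x y = y - x.
    rewrite /dist addnBA ?(ltnW xN)// addnC -addnBA ?(ltnW xy)// modnDl modn_small//.
    exact: leq_ltn_trans (leq_subr _ _) yN.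
  have -> : dist y x = N - (y - x).
    rewrite /dist subnBA ?(ltnW xy)// addnC -addnBAC ?(ltnW yN)// modn_small//.
    by rewrite addnC -[X in _ < X](subnKC (ltnW yN)) ltn_add2r.
  by rewrite subnKC// (leq_trans (leq_subr _ _) (ltnW yN)).
rewrite neq_ltn => /orP[/main //|/main]; by rewrite addnC.
Qed.

Lemma request_tournament_exists (N : nat) :
  exists T : {set arc N}, request_tournament T.
Proof.
exists [set a | (a.1 != a.2) && ((2 * dist a.1 a.2 < N)
          || (2 * dist a.1 a.2 == N) && (a.1 < a.2))].
set T := [set _ | _].
have xorT u v : u != v -> ((u, v) \in T) (+) ((v, u) \in T).
  move=> uv; rewrite !inE /= (eq_sym v u) uv /=.
  have := dist_opp uv; move: (dist u v) (dist v u) => p q pq.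
  have two_lt m n : (2 * m < n + m) = (m < n) by rewrite mul2n -addnn ltn_add2r.
  have two_eq m n : (2 * m == n + m) = (m == n) by rewrite mul2n -addnn eqn_add2r.
  have pE : (2 * p < N) = (p < q) by rewrite -(two_lt p q) [q + p]addnC pq.
  have qE : (2 * q < N) = (q < p) by rewrite -(two_lt q p) pq.
  have pE' : (2 * p == N) = (p == q) by rewrite -(two_eq p q) [q + p]addnC pq.
  have qE' : (2 * q == N) = (q == p) by rewrite -(two_eq q p) pq.
  rewrite pE qE pE' qE'; move: uv; rewrite -val_eqE /=.
  by case: (ltngtP p q) => // _; case: (ltngtP u v).
apply/and3P; split.
- apply/andP; split; first by apply/forallP => u; rewrite inE eqxx.
  by apply/forallP => u; apply/forallP => v; apply/implyP; apply: xorT.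
- apply/forallP => u; apply/forallP => v; apply/implyP => /andP[uv lt].
  by rewrite inE /= uv lt.
- apply/implyP => eN; apply/forallP => i; apply/forallP => j; apply/implyP.
  move=> /eqP ji; apply: xorT; rewrite -val_eqE /= ji neq_ltn.
  rewrite -[X in X < _]addn0 ltn_add2l half_gt0.
  by move: (ltn_ord i) eN; clear; case: N i => [|[|N]].
Qed.

Lemma attainable_cost_exists (C N : nat) :
  0 < C -> exists c, attainable_cost C N c.
Proof.
move=> C0; have [T hT] := request_tournament_exists N.
pose P : {set {set arc N}} := [set [set a] | a in T].
exists (cost P); apply/existsP; exists T; rewrite hT /=.
apply/existsP; exists P; rewrite eqxx andbT; apply/andP; split.
  apply/and3P; split.
  - by rewrite cover_imset; apply/eqP/setP => a; apply/bigcupP/idP =>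
      [[b bT]|aT]; [rewrite inE => /eqP->|exists a; rewrite ?inE].
  - apply/trivIsetP => _ _ /imsetP[a _ ->] /imsetP[b _ ->] ab.
    by rewrite disjoints1 inE; apply: contraNneq ab => ->.
  - by apply/imsetP => -[a _ /setP/(_ a)]; rewrite !inE eqxx.
apply/forall_inP => _ /imsetP[a _ ->]; apply/forall_inP => e _.
apply: leq_trans C0; rewrite -(cards1 a); apply: subset_leq_card.
by apply/subsetP => b; rewrite inE => /andP[].
Qed.

Definition A (C N : nat) (hC : 0 < C) : nat :=
  ex_minn (attainable_cost_exists N hC).

(* Main.v *)
Require Import Defs.
From mathcomp Require Import all_boot all_order all_algebra.
From mathcomp Require Import zify.

Set Implicit Arguments.
Unset Strict Implicit.
Unset Printing Implicit Defensive.

(** Let [B] be an admissible block with endpoint set [V], [p = #|V|], and let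
    the reduced length of an arc of [B] be the number of [u] in [V] such that
    [(u, u+1)] lies on its route.  Arcs of [B] with the same source have
    distinct positive reduced lengths, so [k + 1 - length] sums over [B] to at
    most [p * (k + (k-1) + .. + 1)], while the reduced lengths sum to at most
    [p * C] because each [(u, u+1)] has load at most [C].  Adding up,
    [(k + 1) * #|B| <= p * (k * (k + 1) + r)], and summing over the blocks of a
    valid partition of the [N * (N - 1) / 2] requests gives the bound. *)

Lemma val_iter_ordS (N : nat) (x : 'I_N) (j : nat) :
  iter j (@ordS N) x = (x + j) %% N :> nat.
Proof.
elim: j => [|j IH] /=; first by rewrite addn0 modn_small.
by rewrite IH -[in LHS]addn1 modnDml -addnA addn1.
Qed.

Lemma dist_lt (N : nat) (x y : 'I_N) : dist x y < N.
Proof. by rewrite /dist ltn_mod; case: N x y => [[]|]. Qed.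

Lemma iter_dist (N : nat) (x y : 'I_N) : iter (dist x y) (@ordS N) x = y.
Proof.
apply: val_inj; rewrite /= val_iter_ordS /dist modnDmr addnCA.
by rewrite subnKC ?modnDr ?modn_small // ltnW.
Qed.

Lemma dist_iter (N : nat) (x : 'I_N) (j : nat) :
  j < N -> dist x (iter j (@ordS N) x) = j.
Proof.
move=> jN; rewrite /dist val_iter_ordS modnDml addnC addnA.
by rewrite subnK ?modnDl ?modn_small // ltnW.
Qed.

(** The route leaves exactly the vertices at distance 0, 1, .., [dist x y - 1] from [x], so
    membership becomes a comparison of distances. *)
Lemma mem_route (N : nat) (x y u : 'I_N) :
  ((u, ordS u) \in route (x, y)) = (dist x u < dist x y).
Proof.
apply/imsetP/idP => [[j _ [-> _]]|lt_uy].
  have lt_j : j < dist x y := ltn_ord j.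
  by rewrite dist_iter // (ltn_trans lt_j) // dist_lt.
by exists (Ordinal lt_uy); rewrite //= iter_dist.
Qed.

Definition reduced_length (N : nat) (V : {set 'I_N}) (a : Defs.arc N) : nat :=
  #|[set u in V | (u, ordS u) \in route a]|.

(** The shorter route is a prefix of the longer one, and the cycle arc leaving [y], counted because
    [y] is in [V], lies only on the longer. *)
Lemma reduced_length_mono (N : nat) (V : {set 'I_N}) (x y z : 'I_N) :
  y \in V -> dist x y < dist x z ->
  reduced_length V (x, y) < reduced_length V (x, z).
Proof.
move=> yV lt_yz; apply: proper_card; apply/properP; split.
  apply/subsetP => u; rewrite !inE !mem_route => /andP[-> /= lt_uy].
  exact: ltn_trans lt_yz.
by exists y; rewrite !inE !mem_route yV // ltnn.
Qed.

Lemma reduced_length_inj (N : nat) (V : {set 'I_N}) (x : 'I_N) :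
  {in V &, injective (fun y => reduced_length V (x, y))}.
Proof.
move=> y z yV zV /= eq_yz; suff d_yz : dist x y = dist x z.
  by rewrite -(iter_dist x y) d_yz iter_dist.
case: (ltngtP (dist x y) (dist x z)) => // lt_d.
  by have := reduced_length_mono yV lt_d; rewrite eq_yz ltnn.
by have := reduced_length_mono zV lt_d; rewrite eq_yz ltnn.
Qed.

(** The route starts with the cycle arc leaving [x], so [x] itself is counted. *)
Lemma reduced_length_gt0 (N : nat) (V : {set 'I_N}) (x y : 'I_N) :
  x \in V -> x != y -> 0 < reduced_length V (x, y).
Proof.
move=> xV neq_xy; apply/card_gt0P; exists x; rewrite inE xV mem_route.
rewrite -[x in dist x x]/(iter 0 (@ordS N) x) dist_iter /=; last first.
  by case: N x {V y xV neq_xy} => [[]|].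
rewrite lt0n; apply: contra_neq neq_xy => d0.
by rewrite -(iter_dist x y) d0.
Qed.

(** Truncated subtraction kills the terms with [f i > k]; the others are distinct elements of 1, ..,
    k, whose total is the binomial. *)
Lemma sum_sub_inj (I : finType) (S : {set I}) (f : I -> nat) (k : nat) :
  {in S &, injective f} -> {in S, forall i, 0 < f i} ->
  \sum_(i in S) (k.+1 - f i) <= 'C(k.+1, 2).
Proof.
move=> f_inj f_gt0; rewrite -bin2_sum big_mkord.
pose S' := [set i in S | f i <= k].
(* On [S'] positivity of [f i] gives [k.+1 - f i <= k], so [inord] does not fall back to its default
   there. *)
pose g i : 'I_k.+1 := inord (k.+1 - f i).
have gE i : i \in S' -> g i = k.+1 - f i :> nat.
  by rewrite inE => /andP[/f_gt0 fi0 fik]; rewrite inordK //; lia.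
have g_inj : {in S' &, injective g}.
  move=> i j iS' jS' /(congr1 (@nat_of_ord _)); rewrite !gE //.
  move: iS' jS'; rewrite !inE => /andP[iS fi] /andP[jS fj] eq_ij.
  by apply: f_inj => //; lia.
rewrite (big_setID S') /= [X in _ + X]big1 => [|i]; last first.
  by rewrite !inE => /andP[+ iS]; rewrite iS /=; lia.
have -> : S :&: S' = S' by apply/setIidPr/subsetP => i; rewrite inE => /andP[].
rewrite addn0 -(eq_bigr _ gE) -(big_imset (@nat_of_ord _) g_inj) /=.
by rewrite [leqRHS](bigID (mem (g @: S'))) /= leq_addr.
Qed.

(** Double counting of the pairs of an arc [a] of [B] and a vertex [u] of [V] whose outgoing cycle
    arc lies on the route of [a]. *)
Lemma sum_reduced_length (N : nat) (V : {set 'I_N}) (B : {set Defs.arc N}) :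
  \sum_(a in B) reduced_length V a = \sum_(u in V) load B (u, ordS u).
Proof.
under eq_bigr do rewrite /reduced_length -sum1dep_card big_mkcondr /=.
rewrite exchange_big; apply: eq_bigr => u _.
by rewrite /load -sum1dep_card big_mkcondr.
Qed.

Lemma sum_slack (N k : nat) (B : {set Defs.arc N}) :
  (forall u, (u, u) \notin B) ->
  \sum_(a in B) (k.+1 - reduced_length (endpoints B) a)
    <= #|endpoints B| * 'C(k.+1, 2).
Proof.
move=> irrB; set V := endpoints B.
have srcV x y : (x, y) \in B -> x \in V.
  by move=> xyB; rewrite inE; apply/orP; left; apply/imsetP; exists (x, y).
have tgtV x y : (x, y) \in B -> y \in V.
  by move=> xyB; rewrite inE; apply/orP; right; apply/imsetP; exists (x, y).
(* Arcs are grouped by source [x], then indexed by their targets, which lie in [V] and so have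
   distinct reduced lengths from [x]. *)
rewrite (partition_big fst (mem V)) /= => [|[x y] /srcV //].
rewrite -sum_nat_const; apply: leq_sum => x xV.
rewrite (reindex_onto (fun y => (x, y)) snd) /= => [|[z y] /= /andP[_ /eqP->]//].
pose S := [set y | (x, y) \in B].
rewrite (eq_bigl (mem S)) => [|y]; last by rewrite !inE !eqxx !andbT.
apply: sum_sub_inj => [y z|y]; rewrite !inE.
  by move=> /tgtV yV /tgtV zV; apply: reduced_length_inj.
move=> xyB; apply: reduced_length_gt0 => //.
by apply: contraTneq xyB => <-; apply: irrB.
Qed.

Lemma admissible_card (C N k : nat) (B : {set Defs.arc N}) :
  (forall u, (u, u) \notin B) -> admissible C B ->
  #|B| * k.+1 <= #|endpoints B| * ('C(k.+1, 2) + C).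
Proof.
move=> irrB /forall_inP admB; set V := endpoints B.
have load_le : \sum_(a in B) reduced_length V a <= #|V| * C.
  rewrite sum_reduced_length -sum_nat_const; apply: leq_sum => u _.
  by apply: admB; apply/imsetP; exists u.
(* Since subtraction truncates, each summand is at least [k.+1], even for reduced lengths above
   [k.+1]. *)
apply: leq_trans (_ : \sum_(a in B) (k.+1 - reduced_length V a
                                       + reduced_length V a) <= _).
  by rewrite -sum_nat_const; apply: leq_sum => a _; lia.
by rewrite big_split mulnDr /=; apply: leq_add load_le; apply: sum_slack.
Qed.

(** Out-degree plus in-degree is [N - 1] at each vertex, and summing over vertices counts each arc
    twice. *)
Lemma tournament_card (N : nat) (T : {set Defs.arc N}) :
  tournament T -> #|T| * 2 = N * (N - 1).
Proof.
case/andP => /forallP irrT /forallP xorT.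
have card_swap : #|T| = \sum_(u : 'I_N) \sum_(v : 'I_N) ((v, u) \in T).
  rewrite -sum1_card big_mkcond exchange_big pair_bigA /=.
  by apply: eq_bigr => -[u v] _; case: (_ \in T).
have card_T : #|T| = \sum_(u : 'I_N) \sum_(v : 'I_N) ((u, v) \in T).
  by rewrite card_swap exchange_big.
rewrite muln2 -addnn {1}card_T card_swap -big_split /=.
transitivity (\sum_(u : 'I_N) (N - 1)); last by rewrite sum_nat_const card_ord.
apply: eq_bigr => u _; rewrite -big_split /= (bigD1 u) //=.
rewrite (negbTE (irrT u)) /= add0n.
transitivity (\sum_(v | v != u) 1); last first.
  by rewrite sum1_card (cardC1 u) card_ord subn1.
apply: eq_bigr => v neq_vu.
have := forallP (xorT u) v; rewrite eq_sym neq_vu /=.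
by case: (_ \in T); case: (_ \in T).
Qed.

Lemma valid_partition_cost (C N k : nat) (T : {set Defs.arc N})
    (P : {set {set Defs.arc N}}) :
  tournament T -> valid_partition C T P ->
  #|T| * k.+1 <= cost P * ('C(k.+1, 2) + C).
Proof.
move=> /andP[/forallP irrT _] /andP[partP /forall_inP admP].
rewrite (card_partition partP) /cost !big_distrl /=; apply: leq_sum => B BP.
apply: admissible_card (admP _ BP) => u; apply: contra (irrT u) => uB.
by rewrite -(cover_partition partP); apply/bigcupP; exists B.
Qed.

Theorem theorem1 (C k r N : nat) (hC : (1 <= C)%N)
    (hCkr : C = ((k * (k + 1)) %/ 2 + r)%N)
    (hk : (1 <= k)%N) (hr : (r <= k)%N) (hN : (2 <= N)%N) :
  (Num.ceil ((N * (N - 1))%N%:R / 2%:R *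
             ((k + 1)%N%:R / (k * (k + 1) + r)%N%:R) : rat)
     <= Posz (A N hC))%R.
Proof.
rewrite /A; case: ex_minnP => c /existsP[T /andP[/andP[tT _] /existsP[P]]].
move=> /andP[vP /eqP <-] _; have := valid_partition_cost k tT vP.
(* This makes the division by 2 in [hCkr] exact. *)
have twobin : 'C(k.+1, 2) * 2 = k * (k + 1).
  by rewrite bin2 /= muln2 mulnC addn1 halfK oddM /= andbN subn0.
have -> : 'C(k.+1, 2) + C = k * (k + 1) + r.
  by rewrite hCkr -twobin mulnK //; lia.
have D_gt0 : 0 < k * (k + 1) + r by rewrite addn_gt0 muln_gt0 hk addn1.
move: (k * (k + 1) + r) D_gt0 => D D_gt0 le_cost.
rewrite Num.Theory.ceil_le_int -(tournament_card tT) GRing.natrM.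
rewrite GRing.mulfK ?Num.Theory.pnatr_eq0 // GRing.mulrA.
rewrite Num.Theory.ler_pdivrMr ?Num.Theory.ltr0n //.
by rewrite -pmulrn -!GRing.natrM Num.Theory.ler_nat addn1.
Qed.
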